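(* Let $\delta$ be a real number with $0<\delta\le 2^{-1622}$. Suppose that $\theta$ is a real number such that $\inf_{q\in\mathbb{N}} q^2\|q\theta\|\ge\delta$. Then there exists a real number $\xi$ such that for all integers $A,B$ with $\max(|A|,|B|)>0$ one has $$\|A\theta-B\xi\|\cdot\max(A^2,B^2)\ge\delta .$$
   Context: $\|x\|$ denotes the distance from the real number $x$ to the nearest integer; $\mathbb{N}=\{1,2,3,\dots\}$. *)

(* Defs.v *)
From mathcomp Require Import all_boot all_order all_algebra.
From mathcomp Require Import classical_sets reals.
Set Implicit Arguments.
Unset Strict Implicit.
Unset Printing Implicit Defensive.
Import Order.TTheory GRing.Theory Num.Theory.

Local Open Scope classical_set_scope.
Local Open Scope ring_scope.

(* Distance from x to the subset of integers of R.  The set is nonempty and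
   bounded below by 0, so this [inf] is a genuine infimum. *)
Definition dist_int (R : realType) (x : R) : R :=
  inf [set `|x - m%:~R| | m in [set: int]].

(* Main.v *)
Require Import Defs.
From mathcomp Require Import all_boot all_order all_algebra.
From mathcomp Require Import classical_sets reals boolp.
From mathcomp Require Import zify ring lra.

(** The case B = 0 is the hypothesis on theta, so let B > 0. Call a triple
    (A, B, C) a line, A x - B y + C = 0; it meets the vertical x = theta at the
    ordinate (A theta + C) / B, its center. With M = max(|A|, B), the point xi
    is good for the line exactly when its distance to the center is at least
    delta / (B M^2); call B M^2 the height of the line. The proof finds
    a xi that is good for all lines by a Cantor construction on the vertical
    line, with the survivors of each generation counted.

    Lines are sorted into classes (b, i) by 2^b <= B < 2^(b+1) and
    2^(b+5i) <= M < 2^(b+5i+5), so that B M^2 >= 2^s with s = 3b + 10i. Level n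
    cuts [0, 2^301 delta) into 2^n cells of length delta 2^(301-n), and the
    classes with s = n - 300 delete cells of level n: those within about two
    cell lengths of a center.

    The sum of the deleted lengths diverges, so independence between scales is
    needed. It is provided by lemma count_bad_by: inside one surviving cell J
    of the earlier level n - (300 + i), the class (b, i) deletes at most 2^260
    of the 2^(300+i) cells of level n. The exponent 260 is below
    300 log_2(15/8), so that the number of survivors grows by a factor of at
    least 15/8 at each level (population_grows), and some cell survives at
    every level. The left ends of the leftmost survivors increase to the
    required xi (far_point).

    The bound 2^260 is geometric (cluster_or_spread). Since delta is at most
    2^-1622 the cell J is so short that the lines of the class near J are
    concurrent, or all have the same center: the determinant of any three of
    them is an integer of absolute value less than 1 (concurrent), and parallel
    lines cannot have distinct centers there (parallel_eq). Let P = (p/q, r/q)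
    be the common point and eta = q theta - p. Distinct centers near J are at
    least |eta| / (B B') apart (center_gap), and they lie within M |eta| / (B q)
    of r/q. If |eta| is large the centers are well separated and few of them
    fit near J. If |eta| is small and q is large, they all cluster at r/q. If
    both are small, the pigeonhole principle gives a line through P with
    coefficients of size at most about sqrt q (killing_line). Were it vertical, theta would be approximated too well by a
    rational number; as it is not, it belongs to an earlier class and passes so
    close to J that it would have deleted J. *)

Set Implicit Arguments.
Unset Strict Implicit.
Unset Printing Implicit Defensive.

Import Order.TTheory GRing.Theory Num.Theory.

Local Open Scope classical_set_scope.
Local Open Scope ring_scope.

(** * Counting survivors in a binary tree *)

(** Every d-th term of s raises f by sigma, so a range of sigma t leaves room
    for at most t + 1 such terms. The gap d allows for several indices sharing
    one value of f. *)
Lemma size_separated (R : realFieldType) (s : seq nat) (f : nat -> R) (d : nat)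
    (sigma : R) (t : nat) :
  (0 < d)%N -> 0 < sigma -> sorted ltn s ->
  {in s &, forall k k', (k + d <= k')%N -> f k + sigma <= f k'} ->
  {in s &, forall k k', f k' - f k <= sigma * t%:R} ->
  (size s <= d * t.+1)%N.
Proof.
move=> d_gt0 sigma_gt0 s_sorted f_step f_range; rewrite leqNgt; apply/negP => s_big.
have mem_s i : (i < size s)%N -> nth 0%N s i \in s by move=> ?; apply: mem_nth.
have nth_add i j : (i + j < size s)%N -> (nth 0 s i + j <= nth 0 s (i + j))%N.
  elim: j => [|j IH] ij; first by rewrite !addn0.
  have := sorted_ltn_nth ltn_trans 0%N s_sorted.
  move=> /(_ (i + j)%N (i + j.+1)%N); rewrite !inE => lt_nth.
  have {}lt_nth := lt_nth ltac:(lia) ltac:(lia) ltac:(lia).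
  by have := IH ltac:(lia); move: lt_nth; rewrite /=; lia.
have climb i : (d * i < size s)%N ->
    f (nth 0%N s 0) + sigma * i%:R <= f (nth 0%N s (d * i)).
  elim: i => [|i IH] i_lt; first by rewrite muln0 mulr0 addr0.
  have := IH ltac:(lia).
  have := f_step _ _ (mem_s (d * i)%N ltac:(lia)) (mem_s _ i_lt).
  have -> : (d * i.+1 = d * i + d)%N by lia.
  move=> /(_ (nth_add (d * i)%N d ltac:(lia))).
  have -> : i.+1%:R = i%:R + 1 :> R by rewrite -natr1.
  lra.
have := climb t.+1 s_big.
have := f_range _ _ (mem_s 0%N ltac:(lia)) (mem_s _ s_big).
have -> : t.+1%:R = t%:R + 1 :> R by rewrite -natr1.
lra.
Qed.

(** The children of node k of level n are the nodes 2k and 2k+1 of level n+1;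
    a node is alive when neither it nor any of its ancestors of positive level
    is bad. *)
Fixpoint alive (bad : nat -> nat -> bool) (n k : nat) : bool :=
  if n is m.+1 then alive bad m k./2 && ~~ bad n k else true.

Definition population bad n := (\sum_(0 <= k < 2 ^ n) alive bad n k)%N.

Lemma alive_half bad n m k : alive bad (n + m) k -> alive bad n (k %/ 2 ^ m).
Proof.
elim: m k => [|m IH] k; first by rewrite addn0 divn1.
rewrite addnS /= => /andP[/IH]; by rewrite -divn2 -divnMA -expnS.
Qed.

Lemma alive_not_bad bad n m k : (0 < n)%N ->
  alive bad (n + m) k -> ~~ bad n (k %/ 2 ^ m)%N.
Proof. by move=> n_gt0 /alive_half; case: n n_gt0 => // n _ /andP[]. Qed.

(** A node of level n+1 that is bad for the cause i, with a living parent, has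
    a living ancestor i + w levels up; grouping these nodes by that ancestor
    bounds their number by K times the number of living ancestors. *)
Lemma population_step (bad : nat -> nat -> bool)
    (badc : nat -> nat -> nat -> bool) (K w n : nat) :
  (0 < w)%N ->
  (forall k, bad n.+1 k -> exists2 i, (i + w <= n.+1)%N & badc i n.+1 k) ->
  (forall i J, (i + w <= n.+1)%N -> alive bad (n.+1 - (i + w)) J ->
    (count (fun k => badc i n.+1 (J * 2 ^ (i + w) + k)%N) (iota 0 (2 ^ (i + w)))
     <= K)%N) ->
  (2 * population bad n <= population bad n.+1
    + \sum_(0 <= i < n.+2 - w) K * population bad (n.+1 - (i + w)))%N.
Proof.
move=> w_gt0 bad_cover few_bad.
have sons : (2 * population bad n
    = \sum_(0 <= k < 2 ^ n.+1) alive bad n k./2)%N.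
  rewrite expnSr big_nat_mul /population big_distrr /=; apply: eq_bigr => k _.
  have -> : (k.+1 * 2 = (k * 2).+2)%N by lia.
  rewrite big_nat_recl ?leqnSn // big_nat1.
  have -> : (k * 2)./2 = k by lia.
  have -> : ((k * 2).+1)./2 = k by lia.
  lia.
have union : (2 * population bad n <= population bad n.+1 +
    \sum_(0 <= i < n.+2 - w) \sum_(0 <= k < 2 ^ n.+1)
      (alive bad (n.+1 - (i + w)) (k %/ 2 ^ (i + w)) && badc i n.+1 k))%N.
  rewrite sons exchange_big /population -big_split /=; apply: leq_sum => k _.
  case alive_k: (alive bad n k./2) => //=.
  case bad_k: (bad n.+1 k) => //=.
  have [i i_le badc_k] := bad_cover _ bad_k.
  rewrite (bigD1_seq i) ?iota_uniq ?mem_index_iota //=; last by lia.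
  rewrite badc_k andbT.
  suff -> : alive bad (n.+1 - (i + w)) (k %/ 2 ^ (i + w)) by [].
  have := @alive_half bad (n.+1 - (i + w)) (i + w).-1 k./2.
  have -> : (n.+1 - (i + w) + (i + w).-1 = n)%N by lia.
  move=> /(_ alive_k); rewrite -divn2 -divnMA -expnS.
  by have -> : (i + w).-1.+1 = (i + w)%N by lia.
apply: (leq_trans union); rewrite leq_add2l big_nat_cond [leqRHS]big_nat_cond.
apply: leq_sum => i /andP[i_lt _].
have i_le : (i + w <= n.+1)%N by lia.
have -> : (2 ^ n.+1 = 2 ^ (n.+1 - (i + w)) * 2 ^ (i + w))%N.
  by rewrite -expnD subnK.
rewrite big_nat_mul.
rewrite /population big_distrr /=; apply: leq_sum => J _.
rewrite -{1}[(J * _)%N]add0n big_addn mulSn addnK.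
case alive_J: (alive bad _ J); last first.
  rewrite big_nat_cond big1 // => k /andP[k_lt _].
  by rewrite divnDMl ?expn_gt0 // divn_small ?addn0 ?alive_J //; lia.
rewrite muln1; apply: leq_trans (few_bad _ _ i_le alive_J).
rewrite -sum1_count [leqRHS]big_mkcond /= /index_iota subn0.
apply: leq_sum => k _; rewrite [(_ + k)%N]addnC.
by case: (badc _ _ _); rewrite ?andbF // andbT; case: (alive _ _ _).
Qed.

Lemma geometric_le (R : realFieldType) (beta : R) n : 0 <= beta < 1 ->
  \sum_(0 <= i < n) beta ^+ i <= (1 - beta)^-1.
Proof.
move=> /andP[beta_ge0 beta_lt1].
rewrite -div1r ler_pdivlMr ?subr_gt0 //.
have : (\sum_(0 <= i < n) beta ^+ i) * (1 - beta) = 1 - beta ^+ n.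
  elim: n => [|n IH]; first by rewrite big_geq // mul0r expr0 subrr.
  by rewrite big_nat_recr //= mulrDl IH exprS; ring.
by move=> ->; have := exprn_ge0 n beta_ge0; lra.
Qed.

(** If the population has multiplied by at least 15/8 at all the earlier
    levels, then the living ancestors at distance i + w number at most
    (8/15)^(i+w-1) times the current population, and the losses in
    population_step form a convergent geometric series. The constant 18 bounds
    8 * 15/7: eight because the growth factor may fall short of 2 by 1/8, and
    15/7 for the sum of the powers of 8/15. *)
Lemma population_grows (R : realFieldType) (bad : nat -> nat -> bool)
    (badc : nat -> nat -> nat -> bool) (K w : nat) :
  (0 < w)%N ->
  (18 * K%:R * (8%:R / 15%:R) ^+ w.-1 <= 1 :> R) ->
  (forall n k, bad n.+1 k -> exists2 i, (i + w <= n.+1)%N & badc i n.+1 k) ->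
  (forall n i J, (i + w <= n.+1)%N -> alive bad (n.+1 - (i + w)) J ->
    (count (fun k => badc i n.+1 (J * 2 ^ (i + w) + k)%N) (iota 0 (2 ^ (i + w)))
     <= K)%N) ->
  forall n, (0 < population bad n)%N.
Proof.
move=> w_gt0 K_small bad_cover few_bad.
set beta : R := 8%:R / 15%:R.
pose N n : R := (population bad n)%:R.
have beta_gt0 : 0 < beta by rewrite /beta; lra.
have N0 : N 0%N = 1 by rewrite /N /population expn0 big_nat1.
have growth n : (forall m, (m < n)%N -> N m <= beta * N m.+1) ->
    N n <= beta * N n.+1.
  move=> IH.
  have back d : (d <= n)%N -> N (n - d)%N <= beta ^+ d * N n.
    elim: d => [|d IHd] d_le; first by rewrite subn0 expr0 mul1r.
    have := IH (n - d.+1)%N ltac:(lia).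
    have -> : (n - d.+1).+1 = (n - d)%N by lia.
    move=> /le_trans; apply; rewrite exprS -mulrA ler_pM2l //.
    by apply: IHd; lia.
  have step := population_step w_gt0 (bad_cover n) (few_bad n).
  have : 2 * N n <= N n.+1 + \sum_(0 <= i < n.+2 - w) K%:R * N (n.+1 - (i + w))%N.
    rewrite -(ler_nat R) in step; move: step.
    rewrite natrM natrD natr_sum /N; congr (_ <= _ + _).
    by apply: eq_bigr => i _; rewrite natrM.
  have sum_le : \sum_(0 <= i < n.+2 - w) K%:R * N (n.+1 - (i + w))%N
      <= 8^-1 * N n.
    have /le_trans -> // : \sum_(0 <= i < n.+2 - w) K%:R * N (n.+1 - (i + w))%N
       <= K%:R * beta ^+ w.-1 * N n * \sum_(0 <= i < n.+2 - w) beta ^+ i.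
      rewrite big_distrr /= big_nat_cond [leRHS]big_nat_cond.
      apply: ler_sum => i /andP[i_lt _].
      have -> : (n.+1 - (i + w) = n - (i + w.-1))%N by lia.
      have -> : K%:R * beta ^+ w.-1 * N n * beta ^+ i
          = K%:R * (beta ^+ (i + w.-1) * N n) by rewrite exprD; ring.
      by rewrite ler_wpM2l ?ler0n //; apply: back; lia.
    have N_ge0 : 0 <= N n by rewrite ler0n.
    have geo : \sum_(0 <= i < n.+2 - w) beta ^+ i <= 15 / 7.
      have -> : 15 / 7 = (1 - beta)^-1 by rewrite /beta; field.
      by apply: geometric_le; rewrite /beta; lra.
    apply: le_trans (ler_wpM2l _ geo) _.
      by rewrite !mulr_ge0 ?ler0n // exprn_ge0 // ltW.
    rewrite -/beta in K_small.
    have : 18 * K%:R * beta ^+ w.-1 * N n <= 1 * N n by rewrite ler_wpM2r.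
    lra.
  rewrite /beta; lra.
have grow n : N n <= beta * N n.+1 by elim/ltn_ind: n => n; apply: growth.
move=> n; rewrite -(ltr_nat R) -/(N n).
by elim: n => [|n IH]; [rewrite N0|have := grow n; rewrite /beta; lra].
Qed.

(** * Powers of two and small integers *)

Definition pow2 {R : realFieldType} (z : int) : R := 2 ^ z.

Lemma pow2_gt0 (R : realFieldType) z : 0 < pow2 z :> R.
Proof. exact: exprz_gt0. Qed.

Lemma pow2D (R : realFieldType) x y : pow2 (x + y) = pow2 x * pow2 y :> R.
Proof. by rewrite /pow2 expfzDr // pnatr_eq0. Qed.

Lemma pow2S (R : realFieldType) z : pow2 (1 + z) = pow2 z + pow2 z :> R.
Proof. by rewrite pow2D /pow2 expr1z; ring. Qed.

Lemma ler_pow2 (R : realFieldType) x y : x <= y -> pow2 x <= pow2 y :> R.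
Proof. by apply: ler_weXz2l; rewrite ler1n. Qed.

Lemma ltr_pow2 (R : realFieldType) x y : (pow2 x < pow2 y :> R) = (x < y).
Proof. by apply: ltr_eXz2l; rewrite ltr1n. Qed.

Lemma pow2_nat (R : realFieldType) n : pow2 n%:Z = (2 ^ n)%N%:R :> R.
Proof. by rewrite /pow2 natrX. Qed.

Lemma pow2N (R : realFieldType) z : pow2 (- z) = (pow2 z)^-1 :> R.
Proof. by rewrite /pow2 invr_expz. Qed.

Lemma pow2_0 (R : realFieldType) : pow2 0 = 1 :> R.
Proof. exact: expr0z. Qed.

Global Opaque pow2.

Lemma intr_eq0_small (R : realFieldType) (z : int) : `|z%:~R : R| < 1 -> z = 0.
Proof. by rewrite -intr_norm ltrz1; lia. Qed.

(** Pigeonhole: the h^2 vectors (x, y) with 0 <= x, y < h have two equal values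
    of x p - y r modulo q, and their difference is the required vector. *)
Lemma small_vector (p r : int) (q h : nat) : (0 < q)%N -> (q < h * h)%N ->
  exists x y z : int, [/\ (x != 0) || (y != 0), `|x| < h%:Z, `|y| < h%:Z
    & x * p - y * r + z * q%:Z = 0].
Proof.
move=> q_gt0 q_lt.
have res_lt (v : 'I_h * 'I_h) :
    (absz ((v.1%:Z * p - v.2%:Z * r) %% q%:Z)%Z < q)%N.
  have := ltz_pmod (v.1%:Z * p - v.2%:Z * r) (_ : 0 < q%:Z).
  have := modz_ge0 (v.1%:Z * p - v.2%:Z * r) (_ : q%:Z != 0).
  by move=> /(_ ltac:(lia)) + /(_ ltac:(lia)); lia.
pose residue v := Ordinal (res_lt v).
have /injectivePn[v [v' neq eq_res]] : ~~ injectiveb residue.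
  by apply/injectiveP => /leq_card; rewrite card_prod !card_ord; lia.
have eq_mod : ((v.1%:Z * p - v.2%:Z * r) %% q%:Z
    = (v'.1%:Z * p - v'.2%:Z * r) %% q%:Z)%Z.
  have /(congr1 Posz) := congr1 val eq_res; rewrite /= !gez0_abs //;
    by apply: modz_ge0; lia.
have /dvdzP[z z_def] : (q%:Z %| (v.1%:Z * p - v.2%:Z * r)
    - (v'.1%:Z * p - v'.2%:Z * r))%Z.
  by rewrite -eqz_mod_dvd; apply/eqP.
exists (v.1%:Z - v'.1%:Z), (v.2%:Z - v'.2%:Z), (- z).
have [lt1 lt2] := (ltn_ord v.1, ltn_ord v.2).
have [lt1' lt2'] := (ltn_ord v'.1, ltn_ord v'.2).
split; [|lia|lia|].
  apply: contraNT neq; rewrite negb_or !negbK => /andP[eq1 eq2].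
  case: v v' {lt1 lt2 lt1' lt2' eq_res eq_mod z_def} eq1 eq2 => [a c] [a' c'] /= eq1 eq2.
  by apply/eqP; congr pair; apply: val_inj => /=; lia.
by rewrite mulNr -z_def; ring.
Qed.

(** * Lines and their centers *)

(** The line A x - B y + C = 0, with A, B and C in this order. *)
Record line := Line { xcoef : int; ycoef : int; ccoef : int }.

Definition center (R : realFieldType) (theta : R) L : R :=
  ((xcoef L)%:~R * theta + (ccoef L)%:~R) / (ycoef L)%:~R.

Definition line_norm (R : realFieldType) L : R :=
  Num.max `|(xcoef L)%:~R| (ycoef L)%:~R.

(** A point is good for L when its distance to the center of L is at least
    delta / height L. *)
Definition height (R : realFieldType) L : R := (ycoef L)%:~R * line_norm R L ^+ 2.

(** The ratio M / B is sorted by powers of 2^5 for the sake of the case of large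
    q in cluster_or_spread. There the size of a cluster, in cells, times the
    number of separated centers has a cube of order 2^(5a) B / M, where a is the
    number of levels looked back; this stays bounded when one more level is
    used for each factor 2^5 of M / B. *)
Definition in_class (R : realFieldType) (b i : nat) (L : line) : Prop :=
  (@pow2 R b%:Z <= (ycoef L)%:~R < @pow2 R (b%:Z + 1)) /\
  (@pow2 R (b%:Z + 5 * i%:Z) <= line_norm R L
     < @pow2 R (b%:Z + 5 * i%:Z + 5)).

Definition cross L L' := xcoef L * ycoef L' - xcoef L' * ycoef L.

Lemma centerE (R : realFieldType) (theta : R) L : 0 < ycoef L ->
  (ycoef L)%:~R * center theta L = (xcoef L)%:~R * theta + (ccoef L)%:~R.
Proof. by move=> ?; rewrite /center mulrC divfK // intr_eq0; lia. Qed.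

Lemma in_class_gt0 (R : realFieldType) b i L : in_class R b i L -> 0 < ycoef L.
Proof.
move=> [/andP[+ _] _]; rewrite -(ltr0z R); apply: lt_le_trans; exact: pow2_gt0.
Qed.

Lemma in_class_xcoef (R : realFieldType) b i L : in_class R b i L ->
  `|(xcoef L)%:~R : R| <= pow2 (b%:Z + 5 * i%:Z + 5).
Proof.
move=> [_ /andP[_ /ltW]]; apply: le_trans; by rewrite le_max lexx.
Qed.

Lemma in_class_ycoef (R : realFieldType) b i L : in_class R b i L ->
  `|(ycoef L)%:~R : R| <= pow2 (b%:Z + 1).
Proof.
move=> L_in; rewrite gtr0_norm ?ltr0z ?(in_class_gt0 L_in) //.
by case: L_in => /andP[_ /ltW].
Qed.

Lemma ler_norm_prod4 (R : realFieldType) (x y z t a b c d : R) :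
  `|x| <= a -> `|y| <= b -> `|z| <= c -> `|t| <= d ->
  `|x * y * z * t| <= a * b * c * d.
Proof.
move=> xa yb zc td; rewrite !normrM.
by do !(apply: ler_pM => //; rewrite ?mulr_ge0).
Qed.

Definition det3 L1 L2 L3 := xcoef L3 * (ycoef L1 * ccoef L2 - ycoef L2 * ccoef L1)
  - ycoef L3 * (xcoef L1 * ccoef L2 - xcoef L2 * ccoef L1) + ccoef L3 * cross L1 L2.

(** Eliminating the constant terms through the centers, the determinant is a
    sum of three products of three coefficients and a difference of centers. *)
Lemma concurrent (R : realFieldType) (theta rho : R) b i L1 L2 L3 :
  in_class R b i L1 -> in_class R b i L2 -> in_class R b i L3 ->
  `|center theta L1 - center theta L2| <= rho ->
  `|center theta L2 - center theta L3| <= rho ->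
  `|center theta L1 - center theta L3| <= rho ->
  rho * pow2 (3 * b%:Z + 5 * i%:Z + 9) < 1 ->
  det3 L1 L2 L3 = 0.
Proof.
move=> in1 in2 in3 d12 d23 d13 rho_small.
apply: (@intr_eq0_small R); apply: le_lt_trans rho_small.
have [[x1 x2] x3] := (in_class_xcoef in1, in_class_xcoef in2, in_class_xcoef in3).
have [[y1 y2] y3] := (in_class_ycoef in1, in_class_ycoef in2, in_class_ycoef in3).
have E1 := centerE theta (in_class_gt0 in1).
have E2 := centerE theta (in_class_gt0 in2).
have E3 := centerE theta (in_class_gt0 in3).
rewrite distrC in d12.
have t1 := ler_norm_prod4 x3 y1 y2 d12.
have t2 := ler_norm_prod4 x1 y2 y3 d23.
have t3 := ler_norm_prod4 x2 y1 y3 d13.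
rewrite -!pow2D in t1 t2 t3.
set X := pow2 _ in t1 t2 t3.
have -> : pow2 (3 * b%:Z + 5 * i%:Z + 9) = 4 * X.
  have -> : 4 = pow2 2 :> R by rewrite -[2 : int]/(Posz 2) pow2_nat.
  by rewrite -pow2D; congr (pow2 _); ring.
have -> : (det3 L1 L2 L3)%:~R
  = (xcoef L3)%:~R * (ycoef L1)%:~R * (ycoef L2)%:~R * (center theta L2 - center theta L1)
  - (xcoef L1)%:~R * (ycoef L2)%:~R * (ycoef L3)%:~R * (center theta L2 - center theta L3)
  + (xcoef L2)%:~R * (ycoef L1)%:~R * (ycoef L3)%:~R * (center theta L1 - center theta L3).
  rewrite /det3 /cross !(rmorphD, rmorphB, rmorphN, rmorphM) /=.
  have -> : (ccoef L1)%:~R = (ycoef L1)%:~R * center theta L1 - (xcoef L1)%:~R * theta.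
    by rewrite E1; ring.
  have -> : (ccoef L2)%:~R = (ycoef L2)%:~R * center theta L2 - (xcoef L2)%:~R * theta.
    by rewrite E2; ring.
  have -> : (ccoef L3)%:~R = (ycoef L3)%:~R * center theta L3 - (xcoef L3)%:~R * theta.
    by rewrite E3; ring.
  ring.
have X_gt0 : 0 < X by apply: pow2_gt0.
have rho_ge0 := le_trans (normr_ge0 _) d12.
have : 0 <= X * rho by rewrite mulr_ge0 // ltW.
move: t1 t2 t3; rewrite !ler_norml.
move=> /andP[? ?] /andP[? ?] /andP[? ?] ?; lra.
Qed.

(** For parallel lines the difference of the centers is a rational number with
    denominator B B', and here it is smaller than 1 / (B B'). *)
Lemma parallel_eq (R : realFieldType) (theta rho : R) b i L L' :
  in_class R b i L -> in_class R b i L' ->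
  `|center theta L - center theta L'| <= rho ->
  rho * pow2 (2 * b%:Z + 2) < 1 ->
  cross L L' = 0 -> center theta L = center theta L'.
Proof.
move=> inL inL' dist rho_small par.
have E := centerE theta (in_class_gt0 inL).
have E' := centerE theta (in_class_gt0 inL').
have parR : (xcoef L)%:~R * (ycoef L')%:~R = (xcoef L')%:~R * (ycoef L)%:~R :> R.
  by rewrite -!rmorphM; congr (_ %:~R); move: par; rewrite /cross; lia.
pose z := ccoef L * ycoef L' - ccoef L' * ycoef L.
have zE : z%:~R
  = 1 * (ycoef L)%:~R * (ycoef L')%:~R * (center theta L - center theta L').
  have -> : 1 * (ycoef L)%:~R * (ycoef L')%:~R * (center theta L - center theta L')
    = (ycoef L')%:~R * ((ycoef L)%:~R * center theta L)
      - (ycoef L)%:~R * ((ycoef L')%:~R * center theta L') by ring.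
  rewrite E E' /z rmorphB !rmorphM /=.
  transitivity (((xcoef L)%:~R * (ycoef L')%:~R
      - (xcoef L')%:~R * (ycoef L)%:~R) * theta
    + (ccoef L)%:~R * (ycoef L')%:~R - (ccoef L')%:~R * (ycoef L)%:~R :> R);
    last by ring.
  by rewrite parR; ring.
have z0 : z = 0.
  apply: (@intr_eq0_small R); apply: le_lt_trans rho_small; rewrite zE.
  have one : `|1 : R| <= 1 by rewrite normr1.
  have := ler_norm_prod4 one (in_class_ycoef inL) (in_class_ycoef inL') dist.
  rewrite (mul1r (pow2 _)) -pow2D => /le_trans; apply; rewrite mulrC.
  by have -> : b%:Z + 1 + (b%:Z + 1) = 2 * b%:Z + 2 by ring.
apply/eqP; rewrite -subr_eq0; move/esym/eqP: zE; rewrite z0 mulr0z mul1r !mulf_eq0.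
by rewrite !intr_eq0 (gt_eqF (in_class_gt0 inL)) (gt_eqF (in_class_gt0 inL')).
Qed.

(** * The lines of a class near one point *)

Lemma center_through (R : realFieldType) (theta : R) L p r q :
  0 < ycoef L -> xcoef L * p - ycoef L * r + ccoef L * q = 0 ->
  (ycoef L)%:~R * (q%:~R * center theta L - r%:~R)
    = (xcoef L)%:~R * (q%:~R * theta - p%:~R).
Proof.
move=> L_gt0 /(congr1 (intr : int -> R)).
rewrite !(rmorphD, rmorphN, rmorphM) /= => through.
have E := centerE theta L_gt0.
transitivity (q%:~R * ((ycoef L)%:~R * center theta L) - (ycoef L)%:~R * r%:~R : R).
  by ring.
rewrite E; apply/eqP; rewrite -subr_eq0 -[X in _ == X]through; apply/eqP; ring.
Qed.

(** The line through (p/q, r/q) given by small_vector has coefficients below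
    2^(e+1), which is about 2 sqrt q. If it were vertical, A theta + C would be
    A eta / q, contradicting that theta is badly approximable. Otherwise its
    center is at distance |A eta| / (B q) from r/q, hence close to y. *)
Lemma killing_line (R : realFieldType) (delta theta y : R) (p r : int) (q e : nat) :
  0 < delta ->
  (forall x z : int, x != 0 -> delta <= x%:~R ^+ 2 * `|x%:~R * theta + z%:~R|) ->
  (4 ^ e <= q < 4 ^ e.+1)%N ->
  `|q%:R * theta - p%:~R| <= q%:R * (delta * pow2 (- 3 * e%:Z - 10)) ->
  `|y - r%:~R / q%:R| <= delta * pow2 (- 3 * e%:Z - 4) ->
  exists L, [/\ 0 < ycoef L, height R L < pow2 (3 * e%:Z + 3)
    & height R L * `|center theta L - y| < delta].
Proof.
move=> delta_gt0 bad_theta /andP[q_ge q_lt] eta_le y_near.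
have q_gt0 : (0 < q)%N by apply: leq_trans q_ge; rewrite expn_gt0.
have qR_gt0 : 0 < q%:R :> R by rewrite ltr0n.
have : (q < 2 ^ e.+1 * 2 ^ e.+1)%N by rewrite -expnMn.
move=> /(small_vector p r q_gt0)[x [z [w [xz0 x_lt z_lt through]]]].
wlog z_ge0 : x z w xz0 x_lt z_lt through / 0 <= z.
  move=> gen; case: (lerP 0 z) => [|z_lt0]; first exact: (gen x z w).
  apply: (gen (- x) (- z) (- w)); rewrite ?oppr_eq0 ?normrN //; last by lia.
  by rewrite -oppr0 -through; ring.
set E := pow2 (e%:Z + 1) : R.
have E_gt0 : 0 < E by apply: pow2_gt0.
have E_nat : E = (2 ^ e.+1)%N%:R by rewrite -pow2_nat; congr (pow2 _); lia.
have lt_E (v : int) : `|v| < (2 ^ e.+1)%N%:Z -> `|v%:~R| < E.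
  by move=> v_lt; rewrite E_nat -intr_norm -[ltRHS]/((Posz _)%:~R) ltr_int.
have {x_lt} x_lt := lt_E _ x_lt; have {z_lt} z_lt := lt_E _ z_lt.
set k : R := delta * pow2 (- 3 * e%:Z - 10) in eta_le.
have k_gt0 : 0 < k by rewrite mulr_gt0 ?pow2_gt0.
have EEEk : E * E * E * k = delta * pow2 (-7).
  rewrite mulrCA -!pow2D; congr (_ * pow2 _); ring.
have p7 : pow2 (-7) = 128^-1 :> R.
  by rewrite -[-7](_ : - 7%:Z = _) // pow2N pow2_nat.
have xqk : `|x%:~R * (q%:R * theta - p%:~R)| <= q%:R * (E * k).
  rewrite normrM mulrCA; apply: ler_pM => //; exact: ltW.
case: (eqVneq z 0) => [z0|z_neq0].
  have x_neq0 : x != 0 by move: xz0; rewrite z0 eqxx orbF.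
  have := bad_theta x w x_neq0; rewrite leNgt => /negP[].
  have -> : x%:~R * theta + w%:~R = (x%:~R * (q%:R * theta - p%:~R)) / q%:R.
    move: through => /(congr1 (intr : int -> R)).
    rewrite z0 !(rmorphD, rmorphN, rmorphM) /= => through.
    apply: (mulIf (lt0r_neq0 qR_gt0)); rewrite divfK ?lt0r_neq0 //.
    apply/eqP; rewrite -subr_eq0 -[X in _ == X]through; apply/eqP.
    rewrite -[(Posz q)%:~R]/(q%:R); ring.
  have le_Ek : `|x%:~R * (q%:R * theta - p%:~R) / q%:R| <= E * k.
    by rewrite normrM normfV (gtr0_norm qR_gt0) ler_pdivrMr // (mulrC (E * k)).
  have : x%:~R ^+ 2 * `|x%:~R * (q%:R * theta - p%:~R) / q%:R| <= E ^+ 2 * (E * k).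
    apply: ler_pM => //; rewrite ?sqr_ge0 //.
    by rewrite -real_normK ?num_real // ler_pXn2r ?nnegrE // ltW.
  have -> : E ^+ 2 * (E * k) = E * E * E * k by ring.
  rewrite EEEk p7; lra.
pose L := Line x z w.
have z_gt0 : 0 < z by rewrite lt_neqAle eq_sym z_neq0.
have zR_gt0 : 0 < z%:~R :> R by rewrite ltr0z.
have size_lt : line_norm R L < E.
  by rewrite /line_norm gt_max x_lt -[z%:~R]gtr0_norm.
have size_ge0 : 0 <= line_norm R L by rewrite /line_norm le_max normr_ge0.
exists L; split => //.
  have -> : pow2 (3 * e%:Z + 3) = E * E ^+ 2 :> R.
    by rewrite expr2 -!pow2D; congr (pow2 _); ring.
  rewrite /height; apply: ltr_pM; rewrite ?exprn_ge0 //; first exact: ltW.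
    by rewrite -[z%:~R]gtr0_norm.
  by rewrite ltr_pXn2r ?nnegrE // ltW.
have via : z%:~R * (q%:R * center theta L - r%:~R)
    = x%:~R * (q%:R * theta - p%:~R).
  exact: (@center_through R theta L p r (Posz q) z_gt0 through).
have dist_le : z%:~R * `|center theta L - y| <= E * k + E * (delta * pow2 (- 3 * e%:Z - 4)).
  rewrite -[z%:~R in leLHS]gtr0_norm // -normrM.
  have -> : z%:~R * (center theta L - y)
     = x%:~R * (q%:R * theta - p%:~R) / q%:R - z%:~R * (y - r%:~R / q%:R).
    by rewrite -via; field; rewrite lt0r_neq0.
  apply: le_trans (ler_normB _ _) _; apply: lerD.
    by rewrite normrM normfV (gtr0_norm qR_gt0) ler_pdivrMr // (mulrC (E * k)).
  rewrite normrM; apply: ler_pM => //; exact: ltW.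
rewrite /height -mulrA mulrCA.
have : line_norm R L ^+ 2 * (z%:~R * `|center theta L - y|)
   <= E ^+ 2 * (E * k + E * (delta * pow2 (- 3 * e%:Z - 4))).
  apply: ler_pM => //; rewrite ?exprn_ge0 //.
    by rewrite mulr_ge0 // ltW.
  by rewrite ler_pXn2r ?nnegrE // ltW.
have -> : E ^+ 2 * (E * k + E * (delta * pow2 (- 3 * e%:Z - 4)))
  = E * E * E * k + delta * (E * E * E * pow2 (- 3 * e%:Z - 4)) by ring.
have -> : E * E * E * pow2 (- 3 * e%:Z - 4) = pow2 (-1).
  by rewrite -!pow2D; congr (pow2 _); ring.
rewrite EEEk p7.
have -> : pow2 (-1) = 2^-1 :> R by rewrite -[-1](_ : - 1%:Z = _) // pow2N pow2_nat.
lra.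
Qed.

(** The coordinates of the intersection of L1 and L2 are fractions with
    denominator cross L1 L2. Minimality replaces reduction to lowest terms: it makes this
    denominator a lower bound for all the other cross products. *)
Lemma minimal_cross (F : line -> Prop) L L' : F L -> F L' -> cross L L' != 0 ->
  exists L1 L2, [/\ F L1, F L2, 0 < cross L1 L2
    & forall M M', F M -> F M' -> cross M M' != 0 -> cross L1 L2 <= `|cross M M'|].
Proof.
move=> FL FL' cross0.
have crossC M M' : cross M' M = - cross M M' by rewrite /cross; ring.
pose P q := `[< exists M M', [/\ F M, F M', cross M M' != 0 & absz (cross M M') = q] >].
have exP : exists q, P q by exists (absz (cross L L')); apply/asboolP; exists L, L'.
case: (ex_minnP exP) => q /asboolP[L1 [L2 [F1 F2 cross12 absE]]] q_min.
have minimal M M' : F M -> F M' -> cross M M' != 0 -> q%:Z <= `|cross M M'|.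
  move=> FM FM' crossM.
  suff : (q <= absz (cross M M'))%N by lia.
  by apply: q_min; apply/asboolP; exists M, M'.
case: (ltrP 0 (cross L1 L2)) => cross_sgn.
  exists L1, L2; split=> // M M' FM FM' /(minimal _ _ FM FM'); lia.
exists L2, L1; split=> // [|M M' FM FM' /(minimal _ _ FM FM')].
  by rewrite (crossC L1 L2); lia.
by rewrite (crossC L1 L2); lia.
Qed.

(** The line L passes through (p/q, r/q), so q y(L) - r = A eta / B; subtract
    two such equations and use |A B' - A' B| >= q. *)
Lemma center_gap (R : realFieldType) (theta eta r : R) q L L' :
  0 < ycoef L -> 0 < ycoef L' -> 0 < q -> q <= `|cross L L'| ->
  (ycoef L)%:~R * (q%:~R * center theta L - r) = (xcoef L)%:~R * eta ->
  (ycoef L')%:~R * (q%:~R * center theta L' - r) = (xcoef L')%:~R * eta ->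
  `|eta| <= (ycoef L)%:~R * (ycoef L')%:~R * `|center theta L - center theta L'|.
Proof.
move=> B_gt0 B'_gt0 q_gt0 q_le E E'.
have qR_gt0 : 0 < q%:~R :> R by rewrite ltr0z.
have BR_gt0 : 0 < (ycoef L)%:~R :> R by rewrite ltr0z.
have BR'_gt0 : 0 < (ycoef L')%:~R :> R by rewrite ltr0z.
rewrite -(ler_pM2l qR_gt0).
have {1}<- : `|(cross L L')%:~R| * `|eta|
    = q%:~R * ((ycoef L)%:~R * (ycoef L')%:~R * `|center theta L - center theta L'|).
  rewrite -(gtr0_norm qR_gt0) -(gtr0_norm BR_gt0) -(gtr0_norm BR'_gt0) -!normrM.
  congr `|_|; rewrite /cross rmorphB !rmorphM /=.
  transitivity ((ycoef L')%:~R * ((xcoef L)%:~R * eta) - (ycoef L)%:~R * ((xcoef L')%:~R * eta)).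
    by ring.
  by rewrite -E -E'; ring.
by rewrite ler_wpM2r // -intr_norm ler_int.
Qed.

(** All the lines pass through one point (p/q, r/q) with eta = q theta - p, and
    the size of eta decides between the two alternatives; when q is too small
    for a cluster, killing_line contradicts the safety of y. The exponents come
    from s = 3b + 10i, a look-back of a = 300 + i levels and cells of length
    2 delta / 2^s: the centers are within delta 2^(a+2-s) of y, safety concerns
    heights below 2^(s-a), the radius of a cluster is 2^256 cells, and the
    separation is 2^-257 times the length of the interval around y. In both
    cases the lines touch at most about 2^259 cells. *)
Lemma cluster_or_spread (R : realFieldType) (delta theta y : R) (b i : nat)
    (F : line -> Prop) :
  0 < delta -> delta <= pow2 (- 1622) ->
  (forall x z : int, x != 0 -> delta <= x%:~R ^+ 2 * `|x%:~R * theta + z%:~R|) ->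
  (forall L, F L -> in_class R b i L) ->
  (forall L, F L -> `|center theta L - y| <= delta * pow2 (302 - 3 * b%:Z - 9 * i%:Z)) ->
  (forall L, 0 < ycoef L -> height R L < pow2 (3 * b%:Z + 9 * i%:Z - 300) ->
    delta <= height R L * `|center theta L - y|) ->
  (exists c, forall L, F L ->
     `|center theta L - c| <= delta * pow2 (257 - 3 * b%:Z - 10 * i%:Z)) \/
  (forall L L', F L -> F L' -> center theta L != center theta L' ->
     delta * pow2 (46 - 3 * b%:Z - 9 * i%:Z) <= `|center theta L - center theta L'|).
Proof.
move=> delta_gt0 delta_le bad_theta F_class F_near safe.
pose rho := delta * pow2 (303 - 3 * b%:Z - 9 * i%:Z).
have F_close L L' : F L -> F L' -> `|center theta L - center theta L'| <= rho.
  move=> /F_near dL /F_near dL'; rewrite distrC in dL'.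
  apply: le_trans (ler_distD y _ _) _; apply: le_trans (lerD dL dL') _.
  rewrite /rho -mulrDr ler_pM2l //.
  have -> : 303 - 3 * b%:Z - 9 * i%:Z = 1 + (302 - 3 * b%:Z - 9 * i%:Z) by ring.
  by rewrite pow2S.
have rho_small z : z <= 1318 - 303 + 3 * b%:Z + 9 * i%:Z -> rho * pow2 z < 1.
  move=> z_le; rewrite /rho -mulrA -pow2D.
  (* Any exponent below 1622 gives the strict inequality. *)
  apply: le_lt_trans (_ : pow2 (- 1622) * pow2 1318 < 1).
    apply: ler_pM; rewrite ?(ltW delta_gt0) ?(ltW (pow2_gt0 _ _)) //.
    by rewrite ler_pow2 //; clear -z_le; lia.
  by rewrite -pow2D -(pow2_0 R) ltr_pow2.
have rho_parallel := rho_small (2 * b%:Z + 2) ltac:(clear; lia).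
have rho_det := rho_small (3 * b%:Z + 5 * i%:Z + 9) ltac:(clear; lia).
have F_parallel L L' : F L -> F L' -> cross L L' = 0 -> center theta L = center theta L'.
  move=> FL FL'; apply: parallel_eq rho_parallel; [exact: F_class|exact: F_class|].
  exact: F_close.
have [[L0 [L0' [F0 F0' cross0]]]|no_cross] :=
  pselect (exists L L', [/\ F L, F L' & cross L L' != 0]); last first.
  left; have [[L0 F0]|no_F] := pselect (exists L, F L); last first.
    by exists 0 => L FL; case: no_F; exists L.
  exists (center theta L0) => L FL.
  rewrite (F_parallel L L0) // ?subrr ?normr0 ?mulr_ge0 ?ltW ?pow2_gt0 //.
  by apply: contra_notP no_cross => /eqP cross_neq0; exists L, L0.
have [L1 [L2 [F1 F2 q_gt0 q_min]]] := minimal_cross F0 F0' cross0.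
set q := cross L1 L2 in q_gt0 q_min.
pose p := ycoef L1 * ccoef L2 - ycoef L2 * ccoef L1.
pose r := xcoef L1 * ccoef L2 - xcoef L2 * ccoef L1.
set eta := q%:~R * theta - p%:~R : R.
have F_gt0 L : F L -> 0 < ycoef L by move=> /F_class/in_class_gt0.
have through L : F L -> (ycoef L)%:~R * (q%:~R * center theta L - r%:~R) = (xcoef L)%:~R * eta.
  move=> FL; apply: center_through; first exact: F_gt0.
  have /= := concurrent (F_class _ F1) (F_class _ F2) (F_class _ FL)
     (F_close _ _ F1 F2) (F_close _ _ F2 FL) (F_close _ _ F1 FL) rho_det.
  by [].
have qR_gt0 : 0 < q%:~R :> R by rewrite ltr0z.
(* This threshold is 2^(2b+2), a bound for B B', times the separation. *)
case: (lerP (delta * pow2 (48 - b%:Z - 9 * i%:Z)) `|eta|) => eta_size.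
  right=> L L' FL FL' centers_neq.
  have cross_neq0 : cross L L' != 0.
    by apply: contra_neq centers_neq => /F_parallel; apply.
  have gap := center_gap (F_gt0 _ FL) (F_gt0 _ FL') q_gt0 (q_min _ _ FL FL' cross_neq0)
     (through _ FL) (through _ FL').
  have BB : (ycoef L)%:~R * (ycoef L')%:~R <= pow2 (2 * b%:Z + 2) :> R.
    have -> : 2 * b%:Z + 2 = b%:Z + 1 + (b%:Z + 1) by ring.
    rewrite pow2D; apply: ler_pM; rewrite ?ler0z ?(ltW (F_gt0 _ _)) //.
      exact: le_trans (ler_norm _) (in_class_ycoef (F_class _ FL)).
    exact: le_trans (ler_norm _) (in_class_ycoef (F_class _ FL')).
  rewrite -(ler_pM2l (pow2_gt0 R (2 * b%:Z + 2))).
  apply: le_trans (_ : `|eta| <= _).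
    rewrite mulrCA -pow2D; apply: le_trans eta_size.
    by rewrite ler_pM2l // ler_pow2 //; clear; lia.
  by apply: le_trans gap _; rewrite ler_wpM2r.
left.
have [Q Q_def] : {Q : nat | q = Q%:Z} by exists (absz q); rewrite gez0_abs // ltW.
have Q_gt0 : (0 < Q)%N by clear -q_gt0 Q_def; rewrite -ltz_nat -Q_def.
have QE : q%:~R = Q%:R :> R by rewrite Q_def.
have /andP[Q_ge Q_lt] := trunc_log_bounds (isT : (1 < 4)%N) Q_gt0.
move: (trunc_log 4 Q) Q_ge Q_lt => e Q_ge Q_lt.
have q_ge : pow2 (2 * e%:Z) <= q%:~R :> R.
  have -> : 2 * e%:Z = (2 * e)%N%:Z by rewrite PoszM.
  by rewrite pow2_nat expnM QE ler_nat.
have near_point L : F L ->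
    `|center theta L - r%:~R / q%:~R| <= delta * pow2 (53 - b%:Z - 4 * i%:Z - 2 * e%:Z).
  move=> FL; have B_gt0 : 0 < (ycoef L)%:~R :> R by rewrite ltr0z F_gt0.
  have B_ge : pow2 b%:Z <= (ycoef L)%:~R :> R.
    by case: (F_class _ FL) => /andP[].
  rewrite -(ler_pM2l (mulr_gt0 B_gt0 qR_gt0)).
  rewrite -{1}(gtr0_norm (mulr_gt0 B_gt0 qR_gt0)) -normrM.
  have -> : (ycoef L)%:~R * q%:~R * (center theta L - r%:~R / q%:~R) = (xcoef L)%:~R * eta.
    by rewrite -through //; field; rewrite lt0r_neq0.
  rewrite normrM.
  apply: le_trans (_ : pow2 (b%:Z + 5 * i%:Z + 5) * (delta * pow2 (48 - b%:Z - 9 * i%:Z)) <= _).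
    by apply: ler_pM => //; [exact: in_class_xcoef (F_class _ FL)|exact: ltW].
  apply: le_trans (_ : pow2 b%:Z * pow2 (2 * e%:Z)
    * (delta * pow2 (53 - b%:Z - 4 * i%:Z - 2 * e%:Z)) <= _).
    rewrite mulrCA [leRHS]mulrCA ler_pM2l // -!pow2D ler_pow2 //; clear; lia.
  rewrite ler_pM2r ?mulr_gt0 ?pow2_gt0 //.
  by apply: ler_pM => //; apply: ltW; apply: pow2_gt0.
(* In terms of s and a: whether q^(3/2), about 2^(3e), reaches 2^(s-a-6). If it
   does not, the small line through P has height below 2^(s-a). *)
have [e_large|e_small] := leP (3 * b%:Z + 9 * i%:Z - 306) (3 * e%:Z).
  exists (r%:~R / q%:~R) => L /near_point/le_trans; apply.
  by rewrite ler_pM2l // ler_pow2 //; clear -e_large; lia.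
have [L [L_gt0 L_height]] : exists L, [/\ 0 < ycoef L, height R L < pow2 (3 * e%:Z + 3)
    & height R L * `|center theta L - y| < delta].
  apply: (@killing_line R delta theta y p r Q e) => //; rewrite -?QE //.
  - by rewrite Q_ge.
  - apply: le_trans (ltW eta_size) _.
    apply: le_trans (_ : pow2 (2 * e%:Z) * (delta * pow2 (- 3 * e%:Z - 10)) <= _).
      rewrite mulrCA -pow2D ler_pM2l // ler_pow2 //; clear -e_small; lia.
    by rewrite ler_pM2r // mulr_gt0 // pow2_gt0.
  - apply: le_trans (ler_distD (center theta L1) _ _) _.
    have := F_near _ F1; rewrite distrC => d1; have d2 := near_point _ F1.
    apply: le_trans (lerD d1 d2) _; rewrite -mulrDr ler_pM2l //.
    have -> : - 3 * e%:Z - 4 = 1 + (- 3 * e%:Z - 5) by ring.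
    rewrite pow2S.
    apply: lerD; rewrite ler_pow2 //; clear -e_small; lia.
rewrite ltNge => /negP[]; apply: safe => //.
apply: lt_le_trans L_height _; rewrite ler_pow2 //; clear -e_small; lia.
Qed.

(** * Deleting cells of the vertical line *)

Lemma in_class_exists (R : realFieldType) L : 0 < ycoef L ->
  exists b i, in_class R b i L.
Proof.
move=> B_gt0.
have [B B_def] : {B : nat | ycoef L = B%:Z} by exists (absz (ycoef L)); rewrite gez0_abs // ltW.
have [A A_def] : {A : nat | `|xcoef L| = A%:Z} by exists (absz (xcoef L)); rewrite abszE.
set M := Order.max A B.
have BE : (ycoef L)%:~R = B%:R :> R by rewrite B_def.
have sizeE : line_norm R L = M%:R.
  by rewrite /line_norm BE -intr_norm A_def natr_max.
have {}B_gt0 : (0 < B)%N by rewrite -ltz_nat -B_def.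
have B_le_M : (B <= M)%N by rewrite /M; lia.
have /andP[b_le b_gt] := trunc_log_bounds (isT : (1 < 2)%N) B_gt0.
set b := trunc_log 2 B in b_le b_gt.
have pow_gt0 : (0 < 2 ^ b)%N by rewrite expn_gt0.
have div_gt0 : (0 < M %/ 2 ^ b)%N by rewrite divn_gt0 // (leq_trans b_le).
have /andP[] := trunc_log_bounds (isT : (1 < 32)%N) div_gt0.
set i := trunc_log 32 _; rewrite leq_divRL // ltn_divLR // => i_le i_gt.
have powE n : (2 ^ (b + 5 * n) = 32 ^ n * 2 ^ b)%N by rewrite expnD expnM mulnC.
exists b, i; split; rewrite ?sizeE ?BE.
  have -> : b%:Z + 1 = b.+1%:Z by rewrite -addn1 PoszD.
  by rewrite !pow2_nat ler_nat ltr_nat b_le b_gt.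
have -> : b%:Z + 5 * i%:Z = (b + 5 * i)%N%:Z by rewrite PoszD PoszM.
have -> : (b + 5 * i)%N%:Z + 5 = (b + 5 * i.+1)%N%:Z.
  by rewrite mulnS addnCA [in RHS]PoszD addrC.
by rewrite !pow2_nat ler_nat ltr_nat !powE i_le i_gt.
Qed.

Definition mesh (R : realFieldType) (delta : R) (n : nat) : R :=
  delta * pow2 (301 - n%:Z).

Lemma mesh_gt0 (R : realFieldType) (delta : R) n : 0 < delta -> 0 < mesh delta n.
Proof. by move=> ?; rewrite mulr_gt0 // pow2_gt0. Qed.

Lemma meshD (R : realFieldType) (delta : R) n m :
  mesh delta n = (2 ^ m)%N%:R * mesh delta (n + m).
Proof.
rewrite /mesh mulrCA -pow2_nat -pow2D PoszD; congr (_ * pow2 _); ring.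
Qed.

(** A line of a class acting at level n has delta / height L <= mesh n / 2. The
    larger radius 2 mesh n, measured from the left end k mesh n of a cell,
    keeps the whole cell at distance mesh n from the center. *)
Definition hit (R : realFieldType) (delta theta : R) (n k : nat) (L : line) :=
  `|center theta L - k%:R * mesh delta n| < 2 * mesh delta n.

Definition bad_by (R : realFieldType) (delta theta : R) (i n k : nat) : bool :=
  `[< exists b L, [/\ n = (300 + 3 * b + 10 * i)%N, in_class R b i L
                    & hit delta theta n k L] >].

Definition bad (R : realFieldType) (delta theta : R) (n k : nat) : bool :=
  [exists i : 'I_n, bad_by delta theta i n k].

(** The ancestor at level n of a living cell is not bad, so its left end is at
    least 2 mesh n away from the center; the left end of the cell itself is
    less than mesh n further to the right. *)
Lemma alive_far (R : realFieldType) (delta theta : R) b i L n m k :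
  0 < delta -> in_class R b i L -> n = (300 + 3 * b + 10 * i)%N ->
  alive (bad delta theta) (n + m) k ->
  mesh delta n <= `|center theta L - k%:R * mesh delta (n + m)|.
Proof.
move=> delta_gt0 L_in nE /alive_not_bad => /(_ ltac:(lia)).
have cell_pos := mesh_gt0 (n + m) delta_gt0.
set k0 := (k %/ 2 ^ m)%N; rewrite negb_exists => /forallP not_bad.
have i_lt : (i < n)%N by lia.
have /asboolPn far := not_bad (Ordinal i_lt).
have {}far : 2 * mesh delta n <= `|center theta L - k0%:R * mesh delta n|.
  by rewrite leNgt; apply/negP => hitL; apply: far; exists b, L.
have kE : k%:R * mesh delta (n + m)
    = k0%:R * mesh delta n + (k %% 2 ^ m)%N%:R * mesh delta (n + m).
  by rewrite (meshD delta n m) mulrA -natrM -mulrDl -natrD -divn_eq.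
have rest : `|(k %% 2 ^ m)%N%:R * mesh delta (n + m)| <= mesh delta n.
  rewrite ger0_norm; last exact: mulr_ge0 (ler0n _ _) (ltW cell_pos).
  by rewrite [leRHS](meshD delta n m) ler_pM2r // ler_nat ltnW // ltn_mod expn_gt0.
rewrite kE opprD addrA.
have := lerB_dist (center theta L - k0%:R * mesh delta n) ((k %% 2 ^ m)%N%:R * mesh delta (n + m)).
lra.
Qed.

Lemma four_bins (R : realFieldType) (n m : nat) :
  (0 < n)%N -> (n + 3 <= m)%N ->
  exists2 t : nat, t%:R = pow2 n%:Z + 1 :> R & (4 * t.+1 <= 2 ^ m)%N.
Proof.
move=> n_gt0 m_ge; exists (2 ^ n).+1; first by rewrite pow2_nat -natr1.
apply: leq_trans (_ : 2 ^ (n + 3) <= _)%N; last by rewrite leq_exp2l.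
have : (2 ^ 1 <= 2 ^ n)%N by rewrite leq_exp2l.
by rewrite expnD; move: (2 ^ n)%N => N; rewrite expn1; lia.
Qed.

Lemma height_ge (R : realFieldType) b i L : in_class R b i L ->
  pow2 (3 * b%:Z + 10 * i%:Z) <= height R L.
Proof.
move=> [/andP[B_ge _] /andP[M_ge _]].
have -> : 3 * b%:Z + 10 * i%:Z
    = b%:Z + ((b%:Z + 5 * i%:Z) + (b%:Z + 5 * i%:Z)) by ring.
rewrite !pow2D -!pow2D /height expr2 pow2D [X in _ * X]pow2D.
by do !(apply: ler_pM => //; rewrite ?mulr_ge0 ?(ltW (pow2_gt0 _ _)) //).
Qed.

(** The class of a line of height below 2^(m-300) belongs to a level below
    m, so alive_far applies to it. *)
Lemma alive_safe (R : realFieldType) (delta theta : R) m J L :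
  0 < delta -> alive (bad delta theta) m J ->
  0 < ycoef L -> height R L < pow2 (m%:Z - 300) ->
  delta <= height R L * `|center theta L - J%:R * mesh delta m|.
Proof.
move=> delta_gt0 alive_J /in_class_exists -/(_ R)[b [i L_in]] L_low.
have h_ge := height_ge L_in.
have := le_lt_trans h_ge L_low; rewrite ltr_pow2 => level_lt.
pose n := (300 + 3 * b + 10 * i)%N.
have mE : (n + (m - n) = m)%N by rewrite /n; clear -level_lt; lia.
have := @alive_far R delta theta b i L n (m - n) J delta_gt0 L_in erefl.
rewrite mE => /(_ alive_J) far.
apply: le_trans (_ : pow2 (3 * b%:Z + 10 * i%:Z) * mesh delta n <= _); last first.
  by apply: ler_pM; rewrite // ltW // ?pow2_gt0 ?mesh_gt0.
rewrite /mesh mulrCA -pow2D -[leLHS]mulr1 ler_pM2l // -(pow2_0 R) ler_pow2 //.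
by rewrite /n; clear; lia.
Qed.

(** The cells counted here lie in the cell J of level n - (i + 300), whose left
    end is y. Cells four apart cannot be hit by lines with the same center,
    which is why size_separated is used with the gap 4: on the left ends of the
    cells if the centers cluster, on the centers if they are separated. *)
Lemma count_bad_by (R : realFieldType) (delta theta : R) n i J :
  0 < delta -> delta <= pow2 (- 1622) ->
  (forall x z : int, x != 0 -> delta <= x%:~R ^+ 2 * `|x%:~R * theta + z%:~R|) ->
  (i + 300 <= n)%N -> alive (bad delta theta) (n - (i + 300)) J ->
  (count (fun k => bad_by delta theta i n (J * 2 ^ (i + 300) + k)%N)
     (iota 0 (2 ^ (i + 300))) <= 2 ^ 260)%N.
Proof.
move=> delta_gt0 delta_le bad_theta n_ge alive_J.
set a := (i + 300)%N in n_ge alive_J *.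
(* No class (b, i) acts at level n when n - 300 - 10 i is not a multiple of 3. *)
have [[b nE]|no_b] := pselect (exists b, n = (300 + 3 * b + 10 * i)%N); last first.
  rewrite (eq_count (a2 := pred0)) ?count_pred0 // => k; apply/asboolP.
  by move=> [b [L [nE _ _]]]; apply: no_b; exists b.
set l := mesh delta n.
have l_gt0 : 0 < l by apply: mesh_gt0.
pose y := J%:R * mesh delta (n - a).
have pow_l z : delta * pow2 z = pow2 (z - 301 + n%:Z) * l.
  by rewrite /l /mesh mulrCA -pow2D; congr (_ * pow2 _); ring.
have yE : y = (J * 2 ^ a)%N%:R * l.
  by rewrite /y (meshD delta (n - a) a) subnK // natrM mulrA.
pose F L := in_class R b i L /\
  exists2 k, (k < 2 ^ a)%N & hit delta theta n (J * 2 ^ a + k) L.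
have a_big : 2 <= (2 ^ a)%N%:R :> R.
  by rewrite ler_nat -[X in (X <= _)%N]expn1 leq_exp2l // /a; clear; lia.
have near_cell L : F L -> `|center theta L - y| <= 2 * (2 ^ a)%N%:R * l.
  move=> [_ [k k_lt hitL]]; rewrite /hit -/l natrD mulrDl -yE opprD addrA in hitL.
  have k_le : k%:R * l <= (2 ^ a)%N%:R * l by rewrite ler_pM2r // ler_nat ltnW.
  have k_ge0 : 0 <= k%:R * l by exact: mulr_ge0 (ler0n _ _) (ltW l_gt0).
  have two_le : 2 * l <= (2 ^ a)%N%:R * l by rewrite ler_pM2r.
  have := ler_distD (y + k%:R * l) (center theta L) y.
  rewrite [y + _ - y]addrAC subrr add0r (ger0_norm k_ge0) opprD addrA.
  by move: hitL two_le k_le; clear; lra.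
set s := filter (fun k => bad_by delta theta i n (J * 2 ^ a + k)) (iota 0 (2 ^ a)).
have from_bad k : k \in s -> exists2 L, F L &
    `|center theta L - y - k%:R * l| < 2 * l.
  rewrite mem_filter mem_iota add0n => /andP[/asboolP[b' [L [nE' L_in hitL]]] k_lt].
  have b'E : b' = b by move: nE'; rewrite nE; clear; lia.
  rewrite b'E in L_in; exists L; first by split=> //; exists k.
  by rewrite /hit -/l natrD mulrDl -yE opprD addrA in hitL.
have [] := @cluster_or_spread R delta theta y b i F delta_gt0 delta_le bad_theta.
- by move=> L [].
- move=> L /near_cell/le_trans; apply; rewrite pow_l ler_pM2r // -pow2_nat.
  have -> : 2 * pow2 a%:Z = pow2 (1 + a%:Z) :> R by rewrite pow2S; ring.
  by rewrite ler_pow2 // nE /a; clear; lia.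
- move=> L L_gt0 L_low; apply: (@alive_safe _ _ theta) => //.
  by move: L_low; congr (_ < pow2 _); rewrite nE /a; clear; lia.
- move=> [c F_cluster].
  have [t tE t_le] := four_bins R (isT : (0 < 255)%N) (isT : (255 + 3 <= 260)%N).
  apply: leq_trans t_le; rewrite -size_filter.
  apply: (@size_separated R _ (fun k => k%:R * l) 4 (4 * l)) => //.
  + by rewrite mulr_gt0.
  + by apply: sorted_filter (iota_ltn_sorted _ _); apply: ltn_trans.
  + by move=> k k' _ _ k_le; rewrite -mulrDl ler_pM2r // -natrD ler_nat.
  + move=> k k' /from_bad[L FL Lk] /from_bad[L' FL' Lk'].
    have c_L := F_cluster _ FL; have c_L' := F_cluster _ FL'.
    have radius : delta * pow2 (257 - 3 * b%:Z - 10 * i%:Z) = 2 * pow2 255 * l.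
      have -> : 2 * pow2 255 = pow2 (1 + 255) :> R by rewrite pow2S; ring.
      by rewrite pow_l; congr (pow2 _ * _); rewrite nE; clear; lia.
    rewrite radius in c_L c_L'; rewrite tE.
    move: Lk Lk' c_L c_L'; clear; rewrite !ltr_norml !ler_norml.
    by move=> /andP[? ?] /andP[? ?] /andP[? ?] /andP[? ?]; lra.
- move=> F_spread.
  have /choice[f f_center] : forall k, exists v : R,
      k \in s -> exists2 L, F L & v = center theta L /\ `|v - y - k%:R * l| < 2 * l.
    move=> k; have [k_in|k_out] := boolP (k \in s).
      by have [L FL Lk] := from_bad _ k_in; exists (center theta L) => _; exists L.
    by exists 0.
  have [t tE t_le] := four_bins R (isT : (0 < 257)%N) (isT : (257 + 3 <= 260)%N).
  apply: leq_trans t_le; rewrite -size_filter.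
  have gap_gt0 : 0 < delta * pow2 (46 - 3 * b%:Z - 9 * i%:Z).
    by rewrite mulr_gt0 // pow2_gt0.
  apply: (@size_separated R _ f 4 (delta * pow2 (46 - 3 * b%:Z - 9 * i%:Z))) => //.
  + by apply: sorted_filter (iota_ltn_sorted _ _); apply: ltn_trans.
  + move=> k k' /f_center[L FL [fk Lk]] /f_center[L' FL' [fk' Lk']] k_le.
    have lt_f : f k < f k'.
      have : (k%:R + 4) * l <= k'%:R * l by rewrite ler_pM2r // -natrD ler_nat.
      move: Lk Lk'; clear; rewrite !ltr_norml.
      by move=> /andP[? ?] /andP[? ?] ?; lra.
    have := F_spread L' L FL' FL; rewrite -fk -fk' gt_eqF // => /(_ isT).
    rewrite gtr0_norm ?subr_gt0 //; move: (_ * pow2 _) => g; clear; lra.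
  + move=> k k' /f_center[L FL [fk _]] /f_center[L' FL' [fk' _]].
    have := near_cell _ FL; have := near_cell _ FL'; rewrite -fk -fk'.
    rewrite tE mulrDr mulr1.
    have -> : delta * pow2 (46 - 3 * b%:Z - 9 * i%:Z) * pow2 257
        = 4 * (2 ^ a)%N%:R * l.
      rewrite pow_l mulrAC -pow2D.
      have -> : 46 - 3 * b%:Z - 9 * i%:Z - 301 + n%:Z + 257 = 1 + (1 + a%:Z).
        by rewrite nE /a; clear; lia.
      by rewrite !pow2S pow2_nat; ring.
    move: gap_gt0; rewrite !ler_norml; move: (_ * pow2 _) => g.
    by clear; move=> ? /andP[? ?] /andP[? ?]; lra.
Qed.

(** From 2^9 * 8^10 <= 15^10: each ten levels of growth by 15/8 gain 2^9. *)
Lemma growth_margin (R : realFieldType) :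
  18 * (2 ^ 260)%N%:R * (8%:R / 15%:R) ^+ 299 <= 1 :> R.
Proof.
set beta : R := 8%:R / 15%:R.
have beta_ge0 : 0 <= beta by rewrite /beta; lra.
have beta10 : 0 <= 2 ^+ 9 * beta ^+ 10 <= 1.
  by rewrite /beta; lra.
have beta9 : 0 <= beta ^+ 9 <= 9^-1 by rewrite /beta; lra.
have -> : 299%N = (10 * 29 + 9)%N by [].
have -> : 260%N = (9 * 28 + 8)%N by [].
rewrite natrX [X in 18 * X]exprD [X in _ * X]exprD !exprM.
have -> : 18 * (((2 ^+ 9) ^+ 28) * 2 ^+ 8) * ((beta ^+ 10) ^+ 29 * beta ^+ 9)
   = (18 * 2 ^+ 8 * beta ^+ 10 * beta ^+ 9) * ((2 ^+ 9 * beta ^+ 10) ^+ 28).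
  rewrite (exprS (beta ^+ 10) 28) (exprMn 28 (2 ^+ 9) (beta ^+ 10)).
  move: (beta ^+ 10) (beta ^+ 9) (2 ^+ 9 : R) (2 ^+ 8 : R) => ? ? ? ?; ring.
move/andP: beta10 => [ge0 le1].
have pow_le : (2 ^+ 9 * beta ^+ 10) ^+ 28 <= 1 by apply: exprn_ile1.
have /andP[head_ge0 head_le] : 0 <= 18 * 2 ^+ 8 * beta ^+ 10 * beta ^+ 9 <= 1.
  by rewrite /beta; lra.
exact: mulr_ile1 head_ge0 (exprn_ge0 _ ge0) head_le pow_le.
Qed.

Lemma bad_population (R : realFieldType) (delta theta : R) n :
  0 < delta -> delta <= pow2 (- 1622) ->
  (forall x z : int, x != 0 -> delta <= x%:~R ^+ 2 * `|x%:~R * theta + z%:~R|) ->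
  (0 < population (bad delta theta) n)%N.
Proof.
move=> delta_gt0 delta_le bad_theta.
apply: (@population_grows R _ (bad_by delta theta) (2 ^ 260) 300) => //.
- exact: growth_margin.
- move=> {}n k /existsP[i bad_i]; exists i => //.
  by case/asboolP: bad_i => b [L [nE _ _]]; clear -nE; lia.
- by move=> {}n i J n_ge alive_J; apply: count_bad_by.
Qed.

(** The leftmost survivor of level n+1 is a child of a survivor of level n, so
    the left ends of the leftmost survivors do not decrease as n grows. Each of
    them, from the level of a line on, is far from the center of this line, and
    so is their supremum. *)
Lemma far_point (R : realType) (delta theta : R) :
  0 < delta -> (forall n, (0 < population (bad delta theta) n)%N) ->
  exists xi : R, forall b i L, in_class R b i L ->
    delta * pow2 (- (3 * b%:Z + 10 * i%:Z)) <= `|center theta L - xi|.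
Proof.
move=> delta_gt0 populated.
have survivor n : exists k, (k < 2 ^ n)%N && alive (bad delta theta) n k.
  apply: contrapT => no_k; have := populated n.
  rewrite /population big_nat big1 // => k k_lt.
  by case E: (alive _ _ _) => //; case: no_k; exists k; rewrite E andbT; case/andP: k_lt.
pose k n := ex_minn (survivor n).
have k_alive n : alive (bad delta theta) n (k n).
  by rewrite /k; case: ex_minnP => ? /andP[].
have k_lt n : (k n < 2 ^ n)%N by rewrite /k; case: ex_minnP => ? /andP[].
have k_min n j : alive (bad delta theta) n j -> (k n <= j)%N.
  move=> alive_j; have [j_lt|j_ge] := ltnP j (2 ^ n); last first.
    exact: leq_trans (ltnW (k_lt n)) j_ge.
  by rewrite /k; case: ex_minnP => ? _; apply; rewrite j_lt.
pose y n := (k n)%:R * mesh delta n.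
have y_mono n m : y n <= y (n + m)%N.
  rewrite /y (meshD delta n m) mulrA -natrM ler_pM2r ?mesh_gt0 // ler_nat.
  apply: leq_trans (leq_divM (k (n + m)%N) (2 ^ m)).
  by rewrite leq_mul2r k_min ?orbT //; apply: alive_half.
have y_sup : has_sup (range y).
  split; first by exists (y 0%N), 0%N.
  exists (mesh delta 0) => _ [n _ <-].
  rewrite (meshD delta 0 n) add0n /y ler_pM2r ?mesh_gt0 // ler_nat ltnW //.
exists (sup (range y)) => b i L L_in.
set n := (300 + 3 * b + 10 * i)%N.
have -> : delta * pow2 (- (3 * b%:Z + 10 * i%:Z)) = 2^-1 * mesh delta n.
  rewrite /mesh.
  have -> : 301 - n%:Z = 1 + - (3 * b%:Z + 10 * i%:Z) by rewrite /n; clear; lia.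
  by rewrite pow2S; field.
have c_gt0 : 0 < 2^-1 * mesh delta n by rewrite mulr_gt0 ?invr_gt0 ?mesh_gt0.
have [_ [m _ <-] y_close] := sup_adherent c_gt0 y_sup.
have y_le j : y j <= sup (range y) by apply: (ub_le_sup (proj2 y_sup)); exists j.
have := @alive_far R delta theta b i L n m (k (n + m)%N) delta_gt0 L_in erefl (k_alive _).
rewrite -/(y (n + m)%N).
have := y_le (n + m)%N; have := y_mono m n; rewrite addnC => y_m y_nm far.
have := ler_distD (sup (range y)) (center theta L) (y (n + m)%N).
rewrite (ger0_norm (_ : 0 <= sup (range y) - y (n + m)%N)) ?subr_ge0 //.
lra.
Qed.

(** * From the construction to the distance to the integers *)

Lemma dist_int_le (R : realType) (x : R) (m : int) : dist_int x <= `|x - m%:~R|.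
Proof. by apply: ge_inf; [exists 0 => _ [z _ <-] | exists m]. Qed.

Lemma le_dist_int (R : realType) (x c : R) :
  (forall m : int, c <= `|x - m%:~R|) -> c <= dist_int x.
Proof.
move=> c_le; apply: lb_le_inf; first by exists `|x - 0%:~R|, 0.
by move=> _ [m _ <-].
Qed.

Lemma badly_approximable (R : realType) (delta theta : R) :
  delta <= inf [set q%:R ^+ 2 * dist_int (q%:R * theta)
                  | q in [set q : nat | (0 < q)%N]] ->
  forall x z : int, x != 0 ->
    delta <= x%:~R ^+ 2 * `|x%:~R * theta + z%:~R|.
Proof.
move=> delta_le x z; wlog x_gt0 : x z / 0 < x.
  move=> gen x_neq0; have [x_gt0|] := ltP 0 x; first exact: gen.
  rewrite le_eqVlt (negPf x_neq0) /= => x_lt0.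
  have := gen (- x) (- z); rewrite oppr_gt0 oppr_eq0 !rmorphN sqrrN /=.
  by rewrite mulNr -opprD normrN; apply.
move=> _; have [q xE] : {q : nat | x = q%:Z} by exists (absz x); rewrite gez0_abs // ltW.
apply: le_trans delta_le _.
have dist_ge0 (w : R) : 0 <= dist_int w by apply: le_dist_int.
apply: le_trans (_ : q%:R ^+ 2 * dist_int (q%:R * theta) <= _).
  apply: ge_inf; last by exists q => //=; rewrite -ltz_nat -xE.
  by exists 0 => _ [j _ <-]; rewrite mulr_ge0 ?sqr_ge0.
rewrite xE -[(Posz q)%:~R]/(q%:R) ler_wpM2l ?sqr_ge0 //.
by have := dist_int_le (q%:R * theta) (- z); rewrite rmorphN opprK.
Qed.

Theorem proposition1 (R : realType) (delta : R)
    (delta_gt0 : 0 < delta) (delta_le : delta <= 2 ^- 1622)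
    (theta : R)
    (theta_inf : delta <= inf [set q%:R ^+ 2 * dist_int (q%:R * theta)
                              | q in [set q : nat | (0 < q)%N]]) :
  exists xi : R, forall A B : int, 0 < Num.max `|A| `|B| ->
    delta <= dist_int (A%:~R * theta - B%:~R * xi)
             * Num.max (A%:~R ^+ 2) (B%:~R ^+ 2).
Proof.
have bad_theta := badly_approximable theta_inf.
have delta_le' : delta <= pow2 (- 1622).
  rewrite (_ : 1622 = 1622%N%:Z) ?pow2N ?pow2_nat ?natrX //.
have populated n := bad_population n delta_gt0 delta_le' bad_theta.
have [xi xi_far] := far_point delta_gt0 populated.
exists xi => A B AB_gt0.
set N := Num.max (A%:~R ^+ 2) (B%:~R ^+ 2) : R.
have N_gt0 : 0 < N.
  rewrite lt_max !exprn_even_gt0 //= !intr_eq0.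
  by move: AB_gt0; rewrite lt_max !normr_gt0.
rewrite -ler_pdivrMr //; apply: le_dist_int => m.
rewrite ler_pdivrMr // /N.
wlog B_ge0 : A B m AB_gt0 @N N_gt0 / 0 <= B.
  move=> gen; have [|B_lt0] := leP 0 B; first exact: gen.
  have := gen (- A) (- B) (- m).
  rewrite !normrN !rmorphN !sqrrN /= !mulNr -!opprD normrN; apply=> //.
  by rewrite oppr_ge0 ltW.
have [B0|B_neq0] := eqVneq B 0.
  have A_neq0 : A != 0 by move: AB_gt0; rewrite B0 normr0 lt_max ltxx orbF normr_gt0.
  have := bad_theta A (- m) A_neq0.
  rewrite B0 mul0r subr0 expr0n /= rmorphN mulrC => /le_trans; apply.
  by rewrite ler_wpM2l // le_max lexx.
have B_gt0 : 0 < B by rewrite lt_neqAle eq_sym B_neq0.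
pose L := Line A B (- m).
have [b [i L_in]] := in_class_exists R (B_gt0 : 0 < ycoef L).
have NE : N = line_norm R L ^+ 2.
  rewrite /N /line_norm /= -[A%:~R ^+ 2]real_normK ?num_real //.
  have BR_gt0 : 0 < B%:~R :> R by rewrite ltr0z.
  have A_ge0 := normr_ge0 (A%:~R : R).
  case: (leP `|A%:~R| (B%:~R : R)) => AB.
    by apply/max_idPr; rewrite ler_pXn2r ?nnegrE // ltW.
  by apply/max_idPl; rewrite ler_pXn2r ?nnegrE // ltW.
have -> : A%:~R * theta - B%:~R * xi - m%:~R = B%:~R * (center theta L - xi).
  rewrite mulrBr -[B%:~R]/((ycoef L)%:~R) centerE // /= rmorphN; ring.
rewrite normrM gtr0_norm ?ltr0z // mulrAC -/N NE -[B%:~R * _]/(height R L).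
have := xi_far _ _ _ L_in; rewrite pow2N.
rewrite ler_pdivrMr ?pow2_gt0 // => /le_trans; apply; rewrite mulrC.
by rewrite ler_wpM2r // height_ge.
Qed.
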